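(* For every $\tau\in\{1,\dots,N\}$ and every Borel set $\mathcal{G}_S=\bigcup_{q\in\mathrm{Proj}_{\mathcal{Q}}(\mathcal{G}_S)}\{q\}\times\mathcal{G}_X(q)$ of $\mathcal{S}=\mathcal{Q}\times\mathbb{R}^n$, the law of the state $\boldsymbol{s}_\tau=(\boldsymbol{\sigma}_\tau,\boldsymbol{x}_\tau)$ of the DMSP system satisfies $$\mathbb{P}\{\boldsymbol{s}_\tau\in\mathcal{G}_S\}=\sum_{\overline{q}_\tau\in\Gamma(\tau,\mathcal{G}_S)}\mathbb{P}_{\boldsymbol{x}}^{\tau,\overline{q}_{\tau-1}}\{\boldsymbol{x}_\tau\in\mathcal{G}_X(q_\tau)\}\ \mathbb{P}\{\overline{\boldsymbol{\sigma}}_\tau=\overline{q}_\tau\}.$$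
   Context: DMSP system (discrete-time Markovian switched system with affine parameter-varying stochastic subsystems). Let $N\ge1$, let $\mathcal{Q}\subset\mathbb{R}$ and $\mathcal{P}\subset\mathbb{R}^l$ be finite, and let $A:\mathcal{P}\to\mathbb{R}^{n\times n}$, $B:\mathcal{P}\to\mathbb{R}^{n\times m}$, $F:\mathcal{P}\to\mathbb{R}^{n\times p}$. For $t=0,\dots,N-1$: (i) the discrete state $\boldsymbol{\sigma}_t\in\mathcal{Q}$ is a (possibly time-inhomogeneous) Markov chain with $\boldsymbol{\sigma}_0=q_0$ and transition probabilities $\mathbb{P}^t\{\boldsymbol{\sigma}_{t+1}=q'\mid\boldsymbol{\sigma}_t=q\}$; (ii) the parameter satisfies $\boldsymbol{\lambda}_{t+1}=l_\lambda(\boldsymbol{\sigma}_{t+1},t,\boldsymbol{\lambda}_t)\in\mathcal{P}$, $\boldsymbol{\lambda}_0=\overline{\lambda}_0$, for a given Borel function $l_\lambda:\mathcal{Q}\times\{0,\dots,N-1\}\times\mathcal{P}\to\mathcal{P}$; (iii) the continuous state satisfies $\boldsymbol{x}_{t+1}=A(\boldsymbol{\lambda}_t)\boldsymbol{x}_t+B(\boldsymbol{\lambda}_t)\overline{u}_t+F(\boldsymbol{\lambda}_t)\boldsymbol{w}_t\in\mathbb{R}^n$, $\boldsymbol{x}_0=\overline{x}_0$. The $q_0,\overline\lambda_0,\overline{x}_0$ and the inputs $\overline{u}_t\in\mathbb{R}^m$ are known and deterministic; $\boldsymbol{w}_0,\dots,\boldsymbol{w}_{N-1}$ are IID random vectors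 in $\mathbb{R}^p$ with a density, independent of the discrete state process. Notation: $\overline{\boldsymbol{\sigma}}_\tau=(\boldsymbol{\sigma}_1,\dots,\boldsymbol{\sigma}_\tau)$; for $\overline{q}_\tau=(q_1,\dots,q_\tau)\in\mathcal{Q}^\tau$, $\mathbb{P}\{\overline{\boldsymbol{\sigma}}_\tau=\overline{q}_\tau\}=\prod_{t=0}^{\tau-1}\mathbb{P}^t\{\boldsymbol{\sigma}_{t+1}=q_{t+1}\mid\boldsymbol{\sigma}_t=q_t\}$, and $\overline{q}_{\tau-1}=(q_1,\dots,q_{\tau-1})$ (empty when $\tau=1$, with probability $1$). $\mathrm{Proj}_{\mathcal{Q}}(\mathcal{G}_S)$ is the projection of $\mathcal{G}_S$ onto $\mathcal{Q}$, and $\mathcal{G}_X(q)\subseteq\mathbb{R}^n$ is the (Borel) section of $\mathcal{G}_S$ at $q$. $$\Gamma(\tau,\mathcal{G}_S)=\{\overline{q}_\tau\in\mathcal{Q}^\tau:\ q_\tau\in\mathrm{Proj}_{\mathcal{Q}}(\mathcal{G}_S),\ \mathbb{P}\{\overline{\boldsymbol{\sigma}}_{\tau-1}=\overline{q}_{\tau-1}\}>0\}.$$ $\mathbb{P}_{\boldsymbol{x}}^{\tau,\overline{q}_{\tau-1}}$ is the law of $\boldsymbol{x}_\tau$ for the system $\boldsymbol{x}_{t+1}=A(\overline\lambda_t)\boldsymbol{x}_t+B(\overline\lambda_t)\overline{u}_t+F(\overline\lambda_t)\boldsymbol{w}_t$, $\boldsymbol{x}_0=\overline{x}_0$, with the deterministic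 parameter sequence started at $\overline\lambda_0$ and defined by $\overline\lambda_{t+1}=l_\lambda(q_{t+1},t,\overline\lambda_t)$ for $0\le t\le\tau-2$. *)

(* Defs.v *)
From HB Require Import structures.
From mathcomp Require Import all_boot all_order all_algebra finmap.
From mathcomp Require Import all_classical all_reals all_analysis.
From mathcomp Require Import measurable_realfun.

Set Implicit Arguments.
Unset Strict Implicit.
Unset Printing Implicit Defensive.

Import Order.TTheory GRing.Theory Num.Theory.
Import numFieldNormedType.Exports.

Local Open Scope classical_set_scope.
Local Open Scope ring_scope.

(* Borel sigma-algebra on real matrices, in particular on 'cV[R]_n. *)
HB.instance Definition _ (R : realType) (m n : nat) :=
  @isMeasurable.Build default_measure_display 'M[R]_(m, n)
    <<s (@open 'M[R]_(m, n)) >>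
    (@sigma_algebra0 _ setT _) (@sigma_algebraC _ _)
    (@sigma_algebra_bigcup _ setT _).

Section borel_matrix.
Context {R : realType}.

Lemma measurable_mx_open m n (U : set 'M[R]_(m, n)) : open U -> measurable U.
Proof. exact: sub_sigma_algebra. Qed.

Lemma continuous_mx_coord m n i j : continuous (fun M : 'M[R]_(m, n) => M i j).
Proof.
move=> M A /= nA.
exists (fun i' j' => if (i' == i) && (j' == j) then A else setT).
  move=> i' j'; case: ifP => [/andP[/eqP-> /eqP->]//|_]; exact: filterT.
by move=> N /= /(_ i j); rewrite !eqxx.
Qed.

Lemma measurable_mx_coord m n i j :
  measurable_fun setT (fun M : 'M[R]_(m, n) => M i j).
Proof.
apply: (measurability _ (RGenOpens.measurableE R)).
move=> _ [_ [a [b ->]] <-]; rewrite setTI.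
apply: measurable_mx_open; apply: open_comp; last exact: interval_open.
by move=> M _; exact: continuous_mx_coord.
Qed.

Lemma open_mx_bigcup m n (U : set 'M[R]_(m, n)) : open U ->
  exists D : set ('M[rat]_(m, n) * 'M[rat]_(m, n)),
  U = \bigcup_(c in D)
        [set M | forall i j, ratr (c.1 i j) < M i j < ratr (c.2 i j)].
Proof.
move=> oU.
pose box (c : 'M[rat]_(m, n) * 'M[rat]_(m, n)) :=
  [set M : 'M[R]_(m, n) | forall i j, ratr (c.1 i j) < M i j < ratr (c.2 i j)].
exists [set c | box c `<=` U]; apply/seteqP; split; last first.
  by move=> M [c cU cM]; exact: cU.
move=> M UM; have /= [P PM PU] : nbhs M U by exact: open_nbhs_nbhs.
have ex i j : exists ab : rat * rat, ratr ab.1 < M i j < ratr ab.2 /\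
    [set x : R | ratr ab.1 < x < ratr ab.2] `<=` P i j.
  have [e /= e0 eP] := (nbhs_ballP _ _).1 (PM i j).
  have [a] := rat_in_itvoo (ltac:(by rewrite ltrBlDr ltrDl) : M i j - e < M i j).
  have [b] := rat_in_itvoo (ltac:(by rewrite ltrDl) : M i j < M i j + e).
  rewrite !in_itv /= => /andP[bM be] /andP[ae aM].
  exists (a, b) => /=; rewrite aM bM; split=> // x /= /andP[ax xb].
  apply: eP; rewrite /ball /= ltr_distlC; apply/andP; split.
    exact: lt_trans ae ax.
  exact: lt_trans xb be.
pose f i j := projT1 (cid (ex i j)).
have fP i j := projT2 (cid (ex i j)).
exists (\matrix_(i, j) (f i j).1, \matrix_(i, j) (f i j).2).
  move=> N /= hN; apply: PU => i j.
  by apply: (fP i j).2; have := hN i j; rewrite !mxE.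
by move=> i j; rewrite !mxE; exact: (fP i j).1.
Qed.

Lemma measurable_fun_mx d (T : measurableType d) m n (f : T -> 'M[R]_(m, n)) :
  (forall i j, measurable_fun setT (fun x => f x i j)) ->
  measurable_fun setT f.
Proof.
move=> mf; apply: (measurability (@open 'M[R]_(m, n))) => //.
move=> _ [U oU <-]; rewrite setTI.
have [D ->] := open_mx_bigcup oU; rewrite preimage_bigcup bigcup_mkcond.
apply: countable_bigcupT_measurable => [|c]; first exact: countableP.
case: ifPn => // _.
have -> : f @^-1` [set M | forall i j, ratr (c.1 i j) < M i j < ratr (c.2 i j)]
    = \bigcap_(ij in [set: 'I_m * 'I_n])
        ((fun x => f x ij.1 ij.2) @^-1`
          `]ratr (c.1 ij.1 ij.2), ratr (c.2 ij.1 ij.2)[).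
  apply/seteqP; split=> x /=.
    by move=> h [i j] _ /=; rewrite in_itv /=; exact: h.
  by move=> h i j; have := h (i, j) I; rewrite /= in_itv.
apply: fin_bigcap_measurable => [|[i j] _]; first exact: finite_finset.
by rewrite -[X in measurable X]setTI; exact: mf.
Qed.

End borel_matrix.

Section lebesgue_cV.
Context {R : realType}.

Definition cV_cons p (xv : measurableTypeR R * 'cV[R]_p) : 'cV[R]_p.+1 :=
  \col_i if unlift ord0 i is Some j then xv.2 j ord0 else xv.1.

Definition cV_uncons p (v : 'cV[R]_p.+1) : measurableTypeR R * 'cV[R]_p :=
  (v ord0 ord0, \col_i v (lift ord0 i) ord0).

Lemma cV_consK p : cancel (@cV_cons p) (@cV_uncons p).
Proof.
move=> [x v]; congr pair; first by rewrite mxE unlift_none.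
by apply/colP => i; rewrite !mxE liftK.
Qed.

Lemma measurable_cV_cons p : measurable_fun setT (@cV_cons p).
Proof.
apply: measurable_fun_mx => i j.
under eq_fun do rewrite mxE.
case: unliftP => [k _|_]; last exact: measurable_fst.
apply: (measurableT_comp (measurable_mx_coord k ord0)).
exact: measurable_snd.
Qed.

Lemma measurable_cV_uncons p : measurable_fun setT (@cV_uncons p).
Proof.
apply: measurable_fun_pair; first exact: measurable_mx_coord.
apply: measurable_fun_mx => i j.
rewrite [X in measurable_fun _ X]
  (_ : _ = (fun v : 'cV[R]_p.+1 => v (lift ord0 i) ord0)).
  exact: measurable_mx_coord.
by apply/funext => v; rewrite mxE.
Qed.

Section step.
Variables (p : nat) (mu : {sigma_finite_measure set 'cV[R]_p -> \bar R}).

(* The image of the product of the one- and p-dimensional Lebesgue measures. *)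
Definition lebesgue_cV_step : set 'cV[R]_p.+1 -> \bar R :=
  pushforward (lebesgue_measure \x mu)%E (@cV_cons p).

Let mpreimage (A : set 'cV[R]_p.+1) :
  measurable A -> measurable (@cV_cons p @^-1` A).
Proof.
by move=> mA; rewrite -[X in measurable X]setTI; exact: measurable_cV_cons.
Qed.

Let step0 : lebesgue_cV_step set0 = 0%E.
Proof. by rewrite /lebesgue_cV_step /pushforward preimage_set0 measure0. Qed.

Let step_ge0 A : (0 <= lebesgue_cV_step A)%E.
Proof. by rewrite /lebesgue_cV_step /pushforward. Qed.

Let step_sigma_additive : semi_sigma_additive lebesgue_cV_step.
Proof.
move=> F mF tF mUF; rewrite /lebesgue_cV_step /pushforward preimage_bigcup.
apply: measure_semi_sigma_additive; first by move=> n; exact: mpreimage.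
  apply/trivIsetP => i j _ _ ij; rewrite -preimage_setI.
  by move/trivIsetP : tF => /(_ _ _ I I ij) ->; rewrite preimage_set0.
by rewrite -preimage_bigcup; exact: mpreimage.
Qed.

HB.instance Definition _ := isMeasure.Build _ _ _ lebesgue_cV_step
  step0 step_ge0 step_sigma_additive.

Lemma lebesgue_cV_step_sigma_finite : sigma_finite setT lebesgue_cV_step.
Proof.
have /sigma_finiteP[F [FT ndF Foo]] := @sigma_finiteT _ _ R (@lebesgue_measure R).
have /sigma_finiteP[G [GT ndG Goo]] := sigma_finiteT mu.
exists (fun k => @cV_uncons p @^-1` (F k `*` G k)) => [|k].
  rewrite -preimage_bigcup (_ : \bigcup_k _ = setT) // -subTset => -[x v] _.
  have [k _ Fx] : (\bigcup_k F k) x by rewrite -FT.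
  have [l _ Gv] : (\bigcup_k G k) v by rewrite -GT.
  exists (maxn k l) => //; split.
    by move: x Fx; exact/subsetPset/ndF/leq_maxl.
  by move: v Gv; exact/subsetPset/ndG/leq_maxr.
have [mF Fk] := Foo k; have [mG Gk] := Goo k; split.
  rewrite -[X in measurable X]setTI; apply: measurable_cV_uncons => //.
  exact: measurableX.
rewrite /lebesgue_cV_step /pushforward -comp_preimage.
rewrite (_ : _ \o _ = id); last by apply/funext => x /=; rewrite cV_consK.
by rewrite preimage_id product_measure1E // lte_mul_pinfty // ge0_fin_numE.
Qed.

HB.instance Definition _ := Measure_isSigmaFinite.Build _ _ _ lebesgue_cV_step
  lebesgue_cV_step_sigma_finite.

End step.

Fixpoint lebesgue_cV p : {sigma_finite_measure set 'cV[R]_p -> \bar R} :=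
  match p with
  | 0%N => dirac (0 : 'cV[R]_0)
  | p'.+1 => lebesgue_cV_step (lebesgue_cV p')
  end.

Lemma lebesgue_cV_box p (I : 'I_p -> interval R) :
  lebesgue_cV p [set v | forall i, v i ord0 \in I i] =
  (\prod_(i < p) lebesgue_measure [set` I i])%E.
Proof.
elim: p I => [|p IHp] I /=.
  by rewrite big_ord0 diracE mem_set // => -[].
rewrite big_ord_recl -IHp /lebesgue_cV_step /pushforward.
rewrite -[RHS]product_measure1E //; last first.
  rewrite [X in measurable X](_ : _ = \bigcap_(i in [set: 'I_p])
     ((fun v : 'cV[R]_p => v i ord0) @^-1` [set` I (lift ord0 i)])).
    apply: fin_bigcap_measurable => [|i _]; first exact: finite_finset.
    by rewrite -[X in measurable X]setTI; apply: measurable_mx_coord.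
  by apply/seteqP; split=> v /= h i => [_|]; apply: h.
congr (product_measure1 _ _ _); apply/seteqP; split=> -[x v] /=.
  move=> h; split=> [|i]; first by have := h ord0; rewrite mxE unlift_none.
  by have := h (lift ord0 i); rewrite mxE liftK.
move=> [hx hv] i; rewrite mxE.
by case: unliftP => [j|] ->; [exact: hv|exact: hx].
Qed.

End lebesgue_cV.

Section independence.
Context {d} {Omega : measurableType d} {R : realType} (P : probability Omega R).

Definition process_sigma d' (T : measurableType d') (J : set nat)
    (X : nat -> Omega -> T) : set (set Omega) :=
  <<s \bigcup_(t in J) preimage_set_system setT (X t) measurable >>.

Definition independent_classes (F G : set (set Omega)) :=
  forall A B, F A -> G B -> P (A `&` B) = (P A * P B)%E.

(* Sub-families of X 0, ..., X (N - 1) are covered by taking E t := setT. *)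
Definition mutually_independent d' (T : measurableType d') (N : nat)
    (X : nat -> Omega -> T) :=
  forall E : nat -> set T, (forall t, measurable (E t)) ->
  P (\bigcap_(t in `I_N) X t @^-1` E t) = (\prod_(t < N) P (X t @^-1` E t))%E.

Definition identically_distributed d' (T : measurableType d') (N : nat)
    (X : nat -> Omega -> T) :=
  forall s t, (s < N)%N -> (t < N)%N ->
  forall E, measurable E -> P (X s @^-1` E) = P (X t @^-1` E).

Definition has_density p (X : Omega -> 'cV[R]_p) :=
  exists f : 'cV[R]_p -> R, [/\ measurable_fun setT f, forall v, 0 <= f v &
    forall E, measurable E ->
      P (X @^-1` E) = (\int[lebesgue_cV p]_(v in E) (f v)%:E)%E].

Definition cond_prob (A B : set Omega) : R := fine (P (A `&` B)) / fine (P B).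

End independence.

Record dmsp (R : realType) (n m p l : nat) := Dmsp {
  horizon : nat;
  horizon_gt0 : (0 < horizon)%N;
  dstate : {fset R};
  dparam : {fset 'cV[R]_l};
  matA : dparam -> 'M[R]_n;
  matB : dparam -> 'M[R]_(n, m);
  matF : dparam -> 'M[R]_(n, p);
  (* [trans t q q'] is the probability of moving from q to q' at time t. *)
  trans : nat -> dstate -> dstate -> R;
  trans_ge0 : forall t q q', (t < horizon)%N -> 0 <= trans t q q';
  trans_sum1 : forall t q, (t < horizon)%N ->
    \sum_(q' : dstate) trans t q q' = 1;
  (* Borel measurability is automatic, dstate and dparam being finite. *)
  next_param : dstate -> nat -> dparam -> dparam;
  init_dstate : dstate;
  init_param : dparam;
  init_state : 'cV[R]_n;
  input : nat -> 'cV[R]_m }.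

Section dmsp_theory.
Context {R : realType} {n m p l : nat} (D : dmsp R n m p l).
Local Notation N := (horizon D).
Local Notation Q := (dstate D).

Definition affine_step (lam : dparam D) (t : nat) (x : 'cV[R]_n)
    (w : 'cV[R]_p) : 'cV[R]_n :=
  matA lam *m x + matB lam *m input D t + matF lam *m w.

Section processes.
Context {d} {Omega : measurableType d} (P : probability Omega R).

Definition discrete_markov_chain (sigma : nat -> Omega -> Q) :=
  [/\ forall t, (t <= N)%N ->
        measurable_fun setT (fun o => fsval (sigma t o) : R),
      forall o, sigma 0%N o = init_dstate D
    & forall t (q : nat -> Q), (t < N)%N ->
        let past := [set o | forall s, (s <= t)%N -> sigma s o = q s] in
        (0 < P past)%E ->
        cond_prob P [set o | sigma t.+1 o = q t.+1] past =
        trans t (q t) (q t.+1)].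

Definition iid_noise (sigma : nat -> Omega -> Q)
    (w : nat -> Omega -> 'cV[R]_p) :=
  [/\ forall t, (t < N)%N -> measurable_fun setT (w t),
      mutually_independent P N w,
      identically_distributed P N w,
      forall t, (t < N)%N -> has_density P (w t)
    & independent_classes P (process_sigma `I_N w)
        (process_sigma `I_N.+1 (fun t o => fsval (sigma t o) : R))].

Record dmsp_execution (sigma : nat -> Omega -> Q)
    (lam : nat -> Omega -> dparam D) (x : nat -> Omega -> 'cV[R]_n)
    (w : nat -> Omega -> 'cV[R]_p) : Prop := DmspExecution {
  exec_chain : discrete_markov_chain sigma;
  exec_noise : iid_noise sigma w;
  exec_lam0 : forall o, lam 0%N o = init_param D;
  exec_lamS : forall t o, (t < N)%N ->
    lam t.+1 o = next_param (sigma t.+1 o) t (lam t o);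
  exec_x0 : forall o, x 0%N o = init_state D;
  exec_xS : forall t o, (t < N)%N ->
    x t.+1 o = affine_step (lam t o) t (x t o) (w t o) }.

End processes.

(* A mode sequence [:: q_1; ...; q_k] is read with q_0 := init_dstate D. *)
Definition mode (qs : seq Q) (t : nat) : Q :=
  nth (init_dstate D) (init_dstate D :: qs) t.

Definition path_prob (qs : seq Q) : R :=
  \prod_(t < size qs) trans t (mode qs t) (mode qs t.+1).

Fixpoint det_param (qs : seq Q) (t : nat) : dparam D :=
  if t is t'.+1 then next_param (mode qs t) t' (det_param qs t')
  else init_param D.

Fixpoint det_state Omega (w : nat -> Omega -> 'cV[R]_p) (qs : seq Q)
    (t : nat) (o : Omega) : 'cV[R]_n :=
  if t is t'.+1 then
    affine_step (det_param qs t') t' (det_state w qs t' o) (w t' o)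
  else init_state D.

Definition det_law d (Omega : measurableType d) (P : probability Omega R)
    (w : nat -> Omega -> 'cV[R]_p) (t : nat) (qs : seq Q) :
    set 'cV[R]_n -> \bar R :=
  pushforward P (det_state w qs t).

(* This set is closed in R * 'cV[R]_n, so its Borel subsets are the measurable
   subsets of R * 'cV[R]_n included in it. *)
Definition hybrid_space : set (R * 'cV[R]_n) :=
  [set q | q \in dstate D] `*` setT.

(* q_tau and (q_1, ..., q_(tau-1)) are [mode qs tau] and
   [take tau.-1 qs]. *)
Definition Gamma (tau : nat) (G : set (R * 'cV[R]_n)) : set (tau.-tuple Q) :=
  [set qs : tau.-tuple Q |
    (fst @` G) (fsval (mode qs tau)) /\ 0 < path_prob (take tau.-1 qs)].

End dmsp_theory.

Arguments hybrid_space {R n m p l} D _.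
Arguments Gamma {R n m p l} D tau G _.

(* Main.v *)
(* Conditionally on the mode path the dynamics is affine with deterministic
   parameters.  Split the event over the finitely many paths
   (q_1, ..., q_tau): on each of them the continuous state is a function of the
   noise only, so independence of the noise and of the modes factors the
   probability, and the Markov property gives that of the path.  The paths left
   out of Gamma contribute 0, either because their section of G is empty or
   because a prefix already has probability 0. *)
Require Import Defs.
From mathcomp Require Import all_boot all_order all_algebra finmap.
From mathcomp Require Import all_classical all_reals all_analysis.
From mathcomp Require Import measurable_realfun.

Set Implicit Arguments.
Unset Strict Implicit.
Unset Printing Implicit Defensive.

Import Order.TTheory GRing.Theory Num.Theory.

Local Open Scope classical_set_scope.
Local Open Scope ring_scope.

(** The fibres of [f] cut [A] into finitely many disjoint pieces. Measurability is asked of these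
    pieces, as [I] carries no sigma-algebra. *)
Lemma measure_sum_preimage1 d (T : measurableType d) (R : realType)
    (mu : {measure set T -> \bar R}) (I : finType) (f : T -> I) (A : set T) :
  (forall i, measurable (A `&` f @^-1` [set i])) ->
  mu A = (\sum_i mu (A `&` f @^-1` [set i]))%E.
Proof.
move=> mAf.
have -> : mu A = mu (\bigcup_(i in [set: I]) (A `&` f @^-1` [set i])).
  congr (mu _); apply/seteqP; split => [v Av|v [i _ []//]].
  by exists (f v).
rewrite measure_fin_bigcup//; first last.
- exact: trivIset_preimage1_in.
- exact: finite_finset.
rewrite (@fsbigE _ _ _ _ _ (index_enum I)) ?index_enum_uniq//.
  by apply: eq_bigl => i; exact: mem_set.
by move=> i _; rewrite mem_index_enum.
Qed.

Lemma measurable_fun_mulmx d (T : measurableType d) (R : realType) m n k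
    (M : 'M[R]_(m, n)) (f : T -> 'M[R]_(n, k)) :
  measurable_fun setT f -> measurable_fun setT (fun o => M *m f o).
Proof.
move=> mf; apply: measurable_fun_mx => i j.
under eq_fun do rewrite mxE.
apply: measurable_sum => h; apply: measurable_funM => //.
exact: measurableT_comp (measurable_mx_coord h j) mf.
Qed.

Lemma measurable_fun_addmx d (T : measurableType d) (R : realType) m n
    (f g : T -> 'M[R]_(m, n)) :
  measurable_fun setT f -> measurable_fun setT g ->
  measurable_fun setT (fun o => f o + g o).
Proof.
move=> mf mg; apply: measurable_fun_mx => i j.
under eq_fun do rewrite mxE.
apply: measurable_funD.
  exact: measurableT_comp (measurable_mx_coord i j) mf.
exact: measurableT_comp (measurable_mx_coord i j) mg.
Qed.

(** Modes are compared through the injection [fsval] into [R], where singletons are Borel. [T] is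
    arbitrary so that it can also carry the sigma-algebra generated by the modes. *)
Lemma measurable_path d (T : measurableType d) (R : realType) (Q : {fset R})
    (sigma : nat -> T -> Q) (q : nat -> Q) (t : nat) :
  (forall s, (s <= t)%N ->
    measurable_fun setT (fun o => fsval (sigma s o) : R)) ->
  measurable [set o | forall s, (s <= t)%N -> sigma s o = q s].
Proof.
move=> ms.
rewrite (_ : mkset _ = \bigcap_(s in `I_t.+1)
    ((fun o => fsval (sigma s o)) @^-1` [set fsval (q s)])); last first.
  apply/seteqP; split => o /= h s st; first by rewrite /= h.
  exact/val_inj/h.
apply: fin_bigcap_measurable => [|s st]; first exact: finite_II.
by rewrite -[X in measurable X]setTI; exact: ms.
Qed.

(** Lets the usual measurability lemmas prove membership in [process_sigma], by equipping [Omega]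
    with the generated sigma-algebra. *)
Lemma measurable_process_sigma d (Omega : measurableType d) d'
    (T : measurableType d') (J : set nat) (X : nat -> Omega -> T) (t : nat) :
  J t ->
  measurable_fun [set: g_sigma_algebraType
    (\bigcup_(t in J) preimage_set_system setT (X t) measurable)] (X t).
Proof.
by move=> Jt _ A mA; apply: sub_sigma_algebra; exists t => //; exists A.
Qed.

Section dmsp.
Context {R : realType} {n m p l : nat} (D : dmsp R n m p l).
Local Notation N := (horizon D).
Local Notation Q := (dstate D).

Lemma measurable_det_state d (T : measurableType d)
    (w : nat -> T -> 'cV[R]_p) (qs : seq Q) (t : nat) :
  (forall s, (s < t)%N -> measurable_fun setT (w s)) ->
  measurable_fun setT (det_state w qs t).
Proof.
elim: t => [|t IHt] mw /=; first exact: measurable_cst.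
apply: measurable_fun_addmx; last exact/measurable_fun_mulmx/mw.
apply: measurable_fun_addmx; last exact: measurable_cst.
by apply/measurable_fun_mulmx/IHt => s st; exact/mw/ltnW.
Qed.

Lemma path_prob_ge0 (qs : seq Q) : (size qs <= N)%N -> 0 <= path_prob qs.
Proof.
move=> sN; apply: prodr_ge0 => t _; apply: trans_ge0.
exact: leq_trans (ltn_ord t) sN.
Qed.

(** [mode] puts q_0 in front, so a positive index [t] reads entry [t.-1] of the list; hence [t <= k]
    and not [t < k]. *)
Lemma mode_take k (qs : seq Q) t : (t <= k)%N -> mode (take k qs) t = mode qs t.
Proof. by case: t => [//|t] tk; rewrite /mode /= nth_take. Qed.

Lemma path_prob_take k (qs : seq Q) : (k <= size qs)%N ->
  path_prob (take k qs) = \prod_(t < k) trans t (mode qs t) (mode qs t.+1).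
Proof.
move=> kqs; rewrite /path_prob size_takel//; apply: eq_bigr => t _.
by rewrite !mode_take// ltnW.
Qed.

Lemma path_prob_split k (qs : seq Q) : size qs = k.+1 ->
  path_prob qs = path_prob (take k qs) * trans k (mode qs k) (mode qs k.+1).
Proof.
by move=> sqs; rewrite path_prob_take ?sqs// /path_prob sqs big_ord_recr.
Qed.

Section execution.
Context {d} {Omega : measurableType d} (P : probability Omega R).
Context (sigma : nat -> Omega -> Q).

(** Chain rule, by induction on [t]: each step multiplies the probability of the past by one
    transition. *)
Lemma markov_chain_path (q : nat -> Q) (t : nat) :
  discrete_markov_chain P sigma -> q 0%N = init_dstate D -> (t <= N)%N ->
  P [set o | forall s, (s <= t)%N -> sigma s o = q s] =
  (\prod_(s < t) trans s (q s) (q s.+1))%:E.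
Proof.
move=> [ms s0 chain] q0; elim: t => [|t IHt] tN.
  rewrite big_ord0 -(probability_setT P); congr (P _).
  by apply/seteqP; split => // o _ s; rewrite leqn0 => /eqP ->; rewrite s0.
have {}IHt := IHt (ltnW tN); rewrite big_ord_recr /=.
set past := [set o | forall s, (s <= t)%N -> sigma s o = q s] in IHt.
set next := [set o | sigma t.+1 o = q t.+1].
have mpast : measurable past.
  by apply: measurable_path => s st; exact/ms/(leq_trans st)/ltnW.
have mnext : measurable next.
  rewrite (_ : next = (fun o => fsval (sigma t.+1 o)) @^-1` [set fsval (q t.+1)]).
    by rewrite -[X in measurable X]setTI; exact: ms.
  by apply/seteqP; split => o /= h; [rewrite /= h|exact/val_inj].
rewrite (_ : mkset _ = next `&` past); last first.
  apply/seteqP; split => o /=.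
    by move=> h; split=> [|s st]; apply: h => //; exact: leqW.
  move=> [h1 h2] s; rewrite leq_eqVlt => /orP[/eqP ->//|]; exact: h2.
(* The Markov property is silent on a null past; there both sides vanish, the left by monotonicity
   and the right by [IHt]. *)
have [P0|Ppast] := eqVneq (P past) 0%E.
  have -> : P (next `&` past) = 0%E.
    apply/eqP; rewrite eq_le measure_ge0 andbT -P0.
    by apply: le_measure; rewrite ?inE//; exact: measurableI.
  by move: IHt; rewrite P0 => -[<-]; rewrite mul0r.
have Ppast_gt0 : (0 < P past)%E by rewrite lt0e Ppast measure_ge0.
(* The transition becomes a quotient whose denominator, by [IHt], is the product in front of it and
   cancels. *)
rewrite -(chain _ _ tN Ppast_gt0) -/past -/next /cond_prob IHt /= mulrC divfK.
  by rewrite fineK//; apply: fin_num_measure; exact: measurableI.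
by apply: contra_neq Ppast => h; rewrite IHt h.
Qed.

Context (lam : nat -> Omega -> dparam D) (x : nat -> Omega -> 'cV[R]_n).
Context (w : nat -> Omega -> 'cV[R]_p).
Hypothesis exec : dmsp_execution P sigma lam x w.

(* The state at time k.+1 depends on the parameter up to time k only, hence on
   the truncated path. *)
Lemma exec_det_state (qs : seq Q) k o : (k < N)%N ->
  (forall s, (s <= k)%N -> sigma s o = mode qs s) ->
  x k.+1 o = det_state w (take k qs) k.+1 o.
Proof.
move=> kN sq.
have lamE t : (t <= k)%N -> lam t o = det_param (take k qs) t.
  elim: t => [|t IHt] tk; first by rewrite (exec_lam0 exec).
  have tN : (t < N)%N by exact: leq_trans tk (ltnW kN).
  rewrite /= (exec_lamS exec o tN) IHt; last exact: ltnW.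
  by rewrite sq// mode_take.
suff xE t : (t <= k.+1)%N -> x t o = det_state w (take k qs) t o by exact: xE.
elim: t => [|t IHt] tk; first by rewrite (exec_x0 exec).
have tN : (t < N)%N by exact: leq_trans tk kN.
rewrite /= (exec_xS exec o tN) lamE; last by [].
by rewrite IHt; last exact: ltnW.
Qed.

(** The first event is generated by the noise, the second by the modes, so independence applies. [q]
    is kept apart from [qs] because it will be the full path and [qs] its truncation. *)
Lemma prob_det_state_path (qs : seq Q) (q : nat -> Q) (t : nat)
    (B : set 'cV[R]_n) :
  (t <= N)%N -> measurable B -> q 0%N = init_dstate D ->
  P (det_state w qs t @^-1` B `&`
     [set o | forall s, (s <= t)%N -> sigma s o = q s]) =
  (P (det_state w qs t @^-1` B) *
   (\prod_(s < t) trans s (q s) (q s.+1))%:E)%E.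
Proof.
move=> tN mB q0; rewrite -(markov_chain_path (exec_chain exec))//.
have [_ _ _ _ indep] := exec_noise exec; apply: indep.
  rewrite -[X in process_sigma _ _ X]setTI.
  (* Over the sigma-algebra generated by the noise, measurability of [det_state] is exactly
     membership in that class. *)
  apply: (@measurable_det_state _ (g_sigma_algebraType
    (\bigcup_(t in `I_N) preimage_set_system setT (w t) measurable))) => // s st.
  exact: measurable_process_sigma (leq_trans st tN).
apply: (@measurable_path _ (g_sigma_algebraType (\bigcup_(t in `I_N.+1)
  preimage_set_system setT (fun o => fsval (sigma t o) : R) measurable))).
move=> s st; apply: (measurable_process_sigma
  (X := fun t o => fsval (sigma t o) : R)).
exact: leq_ltn_trans st _.
Qed.

End execution.
End dmsp.

Theorem theorem3 (R : realType) (n m p l : nat) (D : dmsp R n m p l)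
    (d : measure_display) (Omega : measurableType d) (P : probability Omega R)
    (sigma : nat -> Omega -> dstate D) (lam : nat -> Omega -> dparam D)
    (x : nat -> Omega -> 'cV[R]_n) (w : nat -> Omega -> 'cV[R]_p)
    (tau : nat) (G : set (R * 'cV[R]_n)) :
  dmsp_execution P sigma lam x w ->
  (1 <= tau <= horizon D)%N ->
  measurable G -> G `<=` hybrid_space D ->
  pushforward P (fun o => (fsval (sigma tau o) : R, x tau o)) G =
  (\sum_(qs in Gamma D tau G)
     det_law P w tau (take tau.-1 qs) (xsection G (fsval (mode qs tau))) *
     (path_prob qs)%:E)%E.
Proof.
move=> exec; case: tau => [//|k] /= kN mG _.
have [ms s0 _] := exec_chain exec.
have [mw _ _ _ _] := exec_noise exec.
(* Tuple entry [s] is the mode at time [s.+1]; the deterministic mode at time 0 enters [E] through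
   [mode]. *)
pose path o : k.+1.-tuple (dstate D) :=
  [tuple of mkseq (fun s => sigma s.+1 o) k.+1].
pose E (qs : k.+1.-tuple (dstate D)) :=
  [set o | forall s, (s <= k.+1)%N -> sigma s o = mode qs s].
pose S (qs : k.+1.-tuple (dstate D)) :=
  det_state w (take k qs) k.+1 @^-1` xsection G (fsval (mode qs k.+1)).
have pathE qs : path @^-1` [set qs] = E qs.
  apply/seteqP; split => o /=.
    move=> <- [|s] sk; first by rewrite s0.
    by rewrite /mode /= nth_mkseq.
  move=> h; apply/val_inj/(@eq_from_nth _ (init_dstate D)).
    by rewrite size_mkseq size_tuple.
  by move=> i; rewrite size_mkseq => ik; rewrite nth_mkseq// h.
(* On a fixed path the last mode is constant and the state is the deterministic one, so [G] reduces
   to a section. *)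
have GE qs : (fun o => (fsval (sigma k.+1 o) : R, x k.+1 o)) @^-1` G `&`
    path @^-1` [set qs] = S qs `&` E qs.
  have xE o : E qs o -> (fsval (sigma k.+1 o) : R, x k.+1 o) =
      (fsval (mode qs k.+1), det_state w (take k qs) k.+1 o).
    move=> Eo; rewrite (Eo k.+1)// (exec_det_state exec (qs := qs))//.
    by move=> s sk; exact/Eo/leqW.
  rewrite pathE; apply/seteqP; split => o [Go Eo]; split => //.
    by apply: mem_set; rewrite -xE.
  by rewrite /preimage /mkset xE//; exact: set_mem Go.
have mS qs : measurable (S qs).
  rewrite -[X in measurable X]setTI; apply: measurable_det_state => //.
    by move=> s sk; exact/mw/(leq_trans sk).
  exact: measurable_xsection.
have mE qs : measurable (E qs).
  by apply: measurable_path => s sk; exact/ms/(leq_trans sk).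
rewrite /pushforward (measure_sum_preimage1 P (f := path)) => [|qs]; last first.
  by rewrite GE; exact: measurableI.
(* The right-hand sum is padded with zeros outside [Gamma], so that both sums run over all
   tuples. *)
rewrite [RHS]big_mkcond /=; apply: eq_bigr => qs _; rewrite GE.
rewrite (prob_det_state_path exec)//; last exact: measurable_xsection.
have -> : \prod_(s < k.+1) trans s (mode qs s) (mode qs s.+1) = path_prob qs.
  by rewrite -path_prob_take ?size_tuple// take_oversize ?size_tuple.
case: ifPn => // /negP; rewrite inE /Gamma /= => nGamma.
(* Outside [Gamma], a last mode in the projection of [G] forces a null prefix, hence a null path;
   any other last mode has an empty section. *)
have [Gq|nGq] := pselect ((fst @` G) (fsval (mode qs k.+1))).
  have : path_prob (take k qs) == 0.
    rewrite eq_le path_prob_ge0 ?size_takel ?size_tuple ?(ltnW kN)// andbT.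
    by rewrite leNgt; apply/negP => pq; exact: nGamma.
  by rewrite (path_prob_split (size_tuple qs)) => /eqP ->; rewrite mul0r mule0.
rewrite (_ : xsection _ _ = set0) ?preimage_set0 ?measure0 ?mul0e//.
apply/seteqP; split => // v; rewrite /xsection /= inE => Gv; apply: nGq.
by exists (fsval (mode qs k.+1), v).
Qed.
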